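(* Let $\kappa_1,\kappa_2>0$ be constants and let $CI(\cdot)=[l(\cdot),u(\cdot)]$ be a random interval (a measurable function of the data, for each $(n,T)$). Assume that for any $\eta\in(0,1)$, $$\limsup_{n,T\to\infty}\ \sup_{\theta\in\Theta^{(1)}}\mathbb{P}_\theta\left(|CI(X,Y)|>3.92\,(nT)^{-1/2}(1+\kappa_2^2)^{-1/2}(1+\eta)\right)=0 .$$ Then $$\liminf_{n,T\to\infty}\ \inf_{\theta\in\Theta^{(2)}}\mathbb{P}_\theta\left(\beta\in CI(X,Y)\right)\le\frac12+1.96\,(1+\kappa_2^2)^{-1/2}.$$
   Context: Model: $Y=M+X\beta+\varepsilon$ and $X=D+u$, where $Y,X,M,D,\varepsilon,u\in\mathbb{R}^{n\times T}$, $\beta\in\mathbb{R}$, $M,D$ are non-random, the entries of $\varepsilon$ are i.i.d. $N(0,\sigma_\varepsilon^2)$, the entries of $u$ are i.i.d. $N(0,\sigma_u^2)$, and $u,\varepsilon$ are independent. The distribution $\mathbb{P}_\theta$ of the data $(X,Y)$ is indexed by $\theta=(M,D,\sigma_\varepsilon,\sigma_u,\beta)$. Here $\sigma_\varepsilon=\sigma_u=1$. Define (for each $(n,T)$) $$\Theta^{(2)}=\{\theta=(M,D,1,1,\beta):\ \mathrm{rank}\,M\le2,\ \mathrm{rank}\,D=1,\ |\beta|\le1\},$$ $$\Theta^{(1)}=\{\theta=(M,D,1,1,\beta)\in\Theta^{(2)}:\ \mathrm{rank}\,M=1,\ M'D=0,\ MD'=0,\ \|M\|_F\ge\kappa_1\sqrt{nT},\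 \|D\|_F\ge\kappa_2\sqrt{nT}\}.$$ $\|\cdot\|_F$ is the Frobenius norm. For an interval $[l,u]$ with $l\le u$, $|CI(\cdot)|=u(\cdot)-l(\cdot)$. *)

(* Defs.v *)
From HB Require Import structures.
From mathcomp Require Import all_boot all_order all_algebra.
From mathcomp Require Import all_classical all_reals all_analysis.
From mathcomp Require Import measurable_realfun.

Set Implicit Arguments.
Unset Strict Implicit.
Unset Printing Implicit Defensive.

Import Order.TTheory GRing.Theory Num.Theory.
Import numFieldNormedType.Exports.

Local Open Scope classical_set_scope.
Local Open Scope ring_scope.

Definition measure_mx_display : measure_display -> measure_display.
Proof. exact. Qed.

(* The sigma-algebra on matrices is the one generated by the entries; over the
   reals this is the Borel sigma-algebra of R^(n x T). *)
Section measurable_matrix.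
Context {d} {S : measurableType d} (n T : nat).

Definition mx_cylinder : set_system 'M[S]_(n, T) :=
  [set A | exists i j, exists2 B : set S,
    measurable B & A = [set M : 'M[S]_(n, T) | B (M i j)]].

Let mx_set0 : <<s mx_cylinder >> set0.
Proof. exact: sigma_algebra0. Qed.

Let mx_setC A : <<s mx_cylinder >> A -> <<s mx_cylinder >> (~` A).
Proof. exact: sigma_algebraC. Qed.

Let mx_bigcup (F : _^nat) : (forall i, <<s mx_cylinder >> (F i)) ->
  <<s mx_cylinder >> (\bigcup_i (F i)).
Proof. exact: sigma_algebra_bigcup. Qed.

HB.instance Definition _ := @isMeasurable.Build (measure_mx_display d)
  'M[S]_(n, T) <<s mx_cylinder >> mx_set0 mx_setC mx_bigcup.

Lemma measurable_entry i j :
  measurable_fun [set: 'M[S]_(n, T)] (fun M : 'M[S]_(n, T) => M i j).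
Proof.
by move=> _ B mB; rewrite setTI; apply: sub_sigma_algebra; exists i, j, B.
Qed.

Lemma measurable_fun_mxP d' (Z : measurableType d') (f : Z -> 'M[S]_(n, T)) :
  measurable_fun [set: Z] f <->
  forall i j, measurable_fun [set: Z] (fun z => f z i j).
Proof.
split=> [mf i j|mf].
  exact: (measurableT_comp (measurable_entry i j) mf).
apply: (@measurability _ _ _ _ _ _ mx_cylinder) => //.
move=> _ [_ [i [j [B mB ->]]] <-].
exact: (mf i j measurableT B mB).
Qed.

End measurable_matrix.

Section iid.
Context {R : realType} {d} {S : measurableType d} (mu : probability S R).

Definition tcons k (p : S * k.-tuple S) : k.+1.-tuple S :=
  [tuple of p.1 :: p.2].

Lemma measurable_tcons k : measurable_fun [set: S * k.-tuple S] (@tcons k).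
Proof. exact: (measurable_cons measurable_fst measurable_snd). Qed.

HB.instance Definition _ k :=
  isMeasurableFun.Build _ _ _ _ (@tcons k) (@measurable_tcons k).

(* The k-fold product measure mu \x (mu \x ...): law of k i.i.d. draws. *)
Fixpoint iid_law k : probability (k.-tuple S) R :=
  match k return probability (k.-tuple S) R with
  | 0 => \d_[tuple]
  | k'.+1 => distribution (mu \x iid_law k')%E (@tcons k')
  end.

End iid.

(* Sanity check for iid_law: the coordinates are independent with law mu. *)
Lemma iid_law_rect {R : realType} {d} {S : measurableType d}
    (mu : probability S R) k (B : 'I_k -> set S) :
  (forall i, measurable (B i)) ->
  iid_law mu k [set t | forall i, B i (tnth t i)] =
  (\prod_(i < k) mu (B i))%E.
Proof.
elim: k B => [|k IHk] B mB.
  rewrite big_ord0 /= diracE mem_set//.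
  by move=> [].
rewrite big_ord_recl /= /distribution /pushforward.
rewrite [X in product_measure1 _ _ X](_ : _ =
    B ord0 `*` [set t | forall i, B (lift ord0 i) (tnth t i)]); last first.
  apply/seteqP; split=> -[x t] /= h.
    split; first exact: (h ord0).
    by move=> i; have := h (lift ord0 i); rewrite /tcons/= tnthS.
  move=> i; case: (unliftP ord0 i) => [j|] ->.
    by rewrite /tcons/= tnthS; exact: h.2.
  exact: h.1.
have mC : measurable [set t : k.-tuple S |
    forall i, B (lift ord0 i) (tnth t i)].
  rewrite [X in measurable X](_ : _ = \bigcap_(i in [set: 'I_k])
      ((fun t : k.-tuple S => tnth t i) @^-1` B (lift ord0 i))); last first.
    by apply/seteqP; split=> t /= h i; [move=> _|]; apply: h.
  apply: fin_bigcap_measurable => // i _.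
  rewrite -[X in measurable X]setTI.
  exact: measurable_tnth.
rewrite product_measure1E//; congr (_ * _)%E.
exact: (IHk (fun i => B (lift ord0 i))).
Qed.

(* normal_prob is a measure on measurableTypeR R, that is, on R with the same
   sigma-algebra as R but another display: transport it to R. *)
Section normal_law.
Context {R : realType}.

Definition idTR : measurableTypeR R -> R := idfun.

Lemma measurable_idTR : measurable_fun setT idTR.
Proof. by move=> _ B mB; rewrite setTI. Qed.

HB.instance Definition _ :=
  isMeasurableFun.Build _ _ _ _ idTR measurable_idTR.

(* N(0, s^2): the second argument of normal_prob is the standard deviation. *)
Definition normal_law (s : R) : probability R R :=
  distribution (normal_prob 0 s) idTR.

End normal_law.

Section model.
Context {R : realType} (n T : nat).

Local Notation mx := 'M[R]_(n, T).

Definition mx_of_tuple (t : (n * T).-tuple R) : mx :=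
  \matrix_(i, j) tnth t (mxvec_index i j).

Lemma measurable_mx_of_tuple : measurable_fun setT mx_of_tuple.
Proof.
apply/measurable_fun_mxP => i j.
rewrite (_ : (fun _ => _) = fun t => tnth t (mxvec_index i j)).
  exact: measurable_tnth.
by apply/funext => t; rewrite mxE.
Qed.

HB.instance Definition _ :=
  isMeasurableFun.Build _ _ _ _ mx_of_tuple measurable_mx_of_tuple.

(* Law of a random matrix with i.i.d. N(0, s^2) entries. *)
Definition noise_law (s : R) : probability mx R :=
  distribution (iid_law (normal_law s) (n * T)) mx_of_tuple.

Lemma noise_law_rect (s : R) (B : 'I_n -> 'I_T -> set R) :
  (forall i j, measurable (B i j)) ->
  noise_law s [set A : mx | forall i j, B i j (A i j)] =
  (\prod_(i < n) \prod_(j < T) normal_prob 0 s (B i j))%E.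
Proof.
move=> mB; rewrite /= /distribution /pushforward.
pose C k := let ij := enum_val (cast_ord (esym (mxvec_cast n T)) k) in
  B ij.1 ij.2.
have CE i j : C (mxvec_index i j) = B i j.
  by rewrite /C /mxvec_index cast_ordK enum_rankK.
rewrite [X in iid_law _ _ X](_ : _ =
    [set t | forall k, C k (tnth t k)]); last first.
  apply/seteqP; split=> t /= h.
    by move=> k; case/mxvec_indexP: k => i j; rewrite CE; have := h i j; rewrite mxE.
  by move=> i j; rewrite mxE -CE.
rewrite iid_law_rect; last by move=> k; exact: mB.
rewrite pair_bigA /= (reindex (uncurry (@mxvec_index n T))) /=; last first.
  exact: curry_mxvec_bij.
by apply: eq_bigr => -[i j] _; rewrite /= CE.
Qed.

Record param := Param {
  pM : mx;
  pD : mx;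
  sigma_eps : R;
  sigma_u : R;
  beta : R }.

(* ue is the pair (u, eps). *)
Definition data_of_noise (th : param) (ue : mx * mx) : mx * mx :=
  let X := pD th + ue.1 in
  let Y := pM th + beta th *: X + ue.2 in
  (X, Y).

Lemma measurable_data_of_noise th : measurable_fun setT (data_of_noise th).
Proof.
have mu i j : measurable_fun setT (fun ue : mx * mx => ue.1 i j).
  exact: (measurableT_comp (measurable_entry i j) measurable_fst).
have me i j : measurable_fun setT (fun ue : mx * mx => ue.2 i j).
  exact: (measurableT_comp (measurable_entry i j) measurable_snd).
apply/measurable_fun_pairP; split; apply/measurable_fun_mxP => i j /=.
  rewrite (_ : (fun _ => _) = fun ue : mx * mx => pD th i j + ue.1 i j).
    by apply: measurable_funD => //; exact: mu.
  by apply/funext => ue; rewrite !mxE.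
rewrite (_ : (fun _ => _) = fun ue : mx * mx =>
    pM th i j + beta th * (pD th i j + ue.1 i j) + ue.2 i j).
  apply: measurable_funD; last exact: me.
  apply: measurable_funD => //.
  apply: measurable_funM => //.
  by apply: measurable_funD => //; exact: mu.
by apply/funext => ue; rewrite !mxE.
Qed.

HB.instance Definition _ th := isMeasurableFun.Build _ _ _ _
  (data_of_noise th) (measurable_data_of_noise th).

(* The distribution P_theta of the data (X, Y); u and eps are independent. *)
Definition data_law (th : param) : probability (mx * mx)%type R :=
  distribution (noise_law (sigma_u th) \x noise_law (sigma_eps th))%E
    (data_of_noise th).

(* Frobenius norm; the library norm on matrices is the sup norm. *)
Definition normF (A : mx) : R :=
  Num.sqrt (\sum_(i < n) \sum_(j < T) A i j ^+ 2).

Definition Theta2 : set param := [set th |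
  [/\ sigma_eps th = 1 /\ sigma_u th = 1,
      (\rank (pM th) <= 2)%N, \rank (pD th) = 1%N & `|beta th| <= 1]].

Definition Theta1 (kappa1 kappa2 : R) : set param := [set th |
  [/\ Theta2 th,
      \rank (pM th) = 1%N,
      (pM th)^T *m pD th = 0 /\ pM th *m (pD th)^T = 0,
      kappa1 * Num.sqrt (n * T)%:R <= normF (pM th) &
      kappa2 * Num.sqrt (n * T)%:R <= normF (pD th)]].

End model.

Arguments Theta2 {R} n T.
Arguments Theta1 {R} n T kappa1 kappa2.

(* Main.v *)
Require Import Defs.
From mathcomp Require Import all_boot all_order all_algebra.
From mathcomp Require Import all_classical all_reals all_analysis.
From mathcomp Require Import measurable_realfun ring lra.

Set Implicit Arguments.
Unset Strict Implicit.
Unset Printing Implicit Defensive.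

Import Order.TTheory GRing.Theory Num.Theory.
Import numFieldNormedType.Exports.

Local Open Scope classical_set_scope.
Local Open Scope ring_scope.

(** Le Cam's two-point argument, applied to a pair of parameters that the factor
    structure makes hard to tell apart.

    Take rank-one [M] and [D] with [M'D = 0], [MD' = 0] and large norms, so that
    [(M, D, 0)] lies in [Theta1].  For small [b] the parameter [(M - b D, D, b)]
    lies in [Theta2], because [M - b D] has rank at most 2
    ([Theta_confounded_pair]).  Write [P_0] and [P_1] for the two data laws.
    Under [P_0], [X = D + u] and [Y = M + eps]; under [P_1], [X = D + u] and
    [Y = M - b D + b (D + u) + eps = M + b u + eps].  The low-rank term absorbs
    the part of the slope effect that is visible through [D], so [b] acts only
    through the noise [u].

    Given [u], the two laws of [Y] are standard Gaussian with means differing by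
    [v = b u].  The total variation distance of two such laws is at most
    [|v| / 2]: this follows from the affinity [exp (- |v|^2 / 8)] of the two
    laws ([iid_normal_translate_le]).  As [E |u|^2 = nT], averaging over [u]
    gives [P_1 A <= P_0 A + h / 2] as soon as [b^2 nT <= h^2]
    ([data_law_confounded_le]).

    Let [c = 1.96 (1 + kappa2^2)^(-1/2)], [b = 4 c (nT)^(-1/2)] and [h = 4 c].
    Under [P_0] the interval is, up to probability tending to 0, no longer than
    [2 c (nT)^(-1/2) (1 + 1/2) < b]; it therefore cannot contain both 0 and [b],
    and [P_0 (0 in CI) + P_0 (b in CI) <= 1 + o(1)].  Passing from [P_0] to
    [P_1] in the second term shows that the two coverage probabilities add up
    to at most [1 + h / 2 + o(1)], so the smaller one is at most
    [1/2 + h / 4 + o(1) = 1/2 + c + o(1)]. *)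

(** * One-dimensional Gaussian integrals *)

Section normal_shift.
Context {R : realType}.
Local Notation mu := (@lebesgue_measure R).

(** The density of a measure is determined almost everywhere, so the
    Radon-Nikodym derivative of the normal law is its pdf. *)
Lemma ge0_integral_normal_prob (m s : R) (f : measurableTypeR R -> \bar R) :
  measurable_fun setT f -> (forall x, (0 <= f x)%E) ->
  (\int[normal_prob m s]_x f x = \int[mu]_x (f x * (normal_pdf m s x)%:E))%E.
Proof.
move=> mf f0.
have dom := @normal_prob_dominates R m s.
rewrite -(Radon_Nikodym_SigmaFinite.change_of_variables dom)//=.
have mRN := measurable_int _ (Radon_Nikodym_SigmaFinite.f_integrable dom).
apply: ae_eq_integral => //.
- exact: emeasurable_funM.
- apply: emeasurable_funM => //; apply/measurable_EFinP.
  exact: measurable_normal_pdf.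
- apply: ae_eqe_mul2l; apply: integral_ae_eq => //.
  + exact: Radon_Nikodym_SigmaFinite.f_integrable.
  + apply/measurable_EFinP; exact: measurable_normal_pdf.
  + by move=> A _ mA; rewrite -Radon_Nikodym_SigmaFinite.f_integral.
Qed.

Lemma lebesgue_measure_shift (v : R) (A : set R) : measurable A ->
  pushforward mu (+%R v : _ -> measurableTypeR R) A = mu A.
Proof.
move=> mA.
apply/esym; apply: lebesgue_measure_unique => // [|ms _ [[a b] _ <-]].
  exact: measurable_funD.
rewrite /= /pushforward (_ : _ @^-1` _ = `](a - v), (b - v)]%classic).
  rewrite !lebesgue_measure_itv/= !lte_fin ltrD2r; case: ifP => // _.
  by rewrite -!EFinB; congr EFin; ring.
by apply/seteqP; split=> x /=; rewrite !in_itv/= => /andP[? ?];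
  apply/andP; split; lra.
Qed.

Lemma ge0_integral_lebesgue_shift (v : R) (f : measurableTypeR R -> \bar R) :
  measurable_fun setT f -> (forall x, (0 <= f x)%E) ->
  (\int[mu]_x f (v + x)%R = \int[mu]_x f x)%E.
Proof.
move=> mf f0.
have ms : measurable_fun setT (+%R v : measurableTypeR R -> measurableTypeR R).
  exact: measurable_funD.
have /esym -> := @ge0_integral_pushforward _ _ _ _ _ _ ms mu setT f
  measurableT mf (fun x _ => f0 x).
by apply: eq_measure_integral => //= A mA _; exact: lebesgue_measure_shift.
Qed.

(** The one-dimensional Cameron-Martin formula: the density of N(v, 1) with
    respect to N(0, 1) is [expR (v x - v^2 / 2)]. *)
Lemma ge0_integral_normal_law_shift (v : R) (f : R -> \bar R) :
  measurable_fun setT f -> (forall x, (0 <= f x)%E) ->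
  (\int[normal_law 1]_x f (v + x)%R =
   \int[normal_law 1]_x (f x * (expR (v * x - v ^+ 2 / 2))%:E))%E.
Proof.
move=> mf f0.
have ms : measurable_fun setT (fun x : R => v + x) by exact: measurable_funD.
have me : measurable_fun setT (fun x : R => (expR (v * x - v ^+ 2 / 2))%:E).
  apply/measurable_EFinP; apply: measurableT_comp => //.
  by apply: measurable_funB => //; exact: measurable_funM.
have e0 x : (0 <= (expR (v * x - v ^+ 2 / 2))%:E)%E.
  by rewrite lee_fin expR_ge0.
rewrite !ge0_integral_distribution//; last 3 first.
- exact: emeasurable_funM.
- by move=> x; exact: mule_ge0.
- exact: (measurableT_comp mf).
rewrite !ge0_integral_normal_prob//=; last 3 first.
- exact: (emeasurable_funM mf me).
- by move=> x; exact: mule_ge0.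
- exact: (measurableT_comp mf ms).
rewrite -[RHS](ge0_integral_lebesgue_shift v); last 2 first.
- apply: emeasurable_funM; first exact: (emeasurable_funM mf me).
  by apply/measurable_EFinP; exact: measurable_normal_pdf.
- by move=> x; rewrite !mule_ge0// lee_fin normal_pdf_ge0.
apply: eq_integral => x _; rewrite /idTR/= -muleA -EFinM; congr (_ * _%:E)%E.
rewrite normal_pdfE ?oner_eq0// /normal_fun mulrCA -expRD; congr (_ * expR _).
by rewrite expr1n; field.
Qed.

Lemma normal_law_mgf (v : R) :
  (\int[normal_law 1]_x (expR (v * x))%:E = (expR (v ^+ 2 / 2))%:E)%E.
Proof.
have me : measurable_fun setT (fun x : R => (expR (v * x))%:E).
  by apply/measurable_EFinP; apply: measurableT_comp => //;
    exact: measurable_funM.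
have := @ge0_integral_normal_law_shift v (cst 1%E) (measurable_cst _)
  (fun=> lee01).
rewrite integral_cst// mul1e [X in X = _ -> _]probability_setT.
under eq_integral do rewrite mul1e expRB mulrC EFinM.
rewrite ge0_integralZl//.
move=> /(congr1 (mule (expR (v ^+ 2 / 2))%:E)).
by rewrite mule1 muleA -EFinM divff ?mul1e// gt_eqF// expR_gt0.
Qed.

Lemma expR_ge_quadratic (x : R) : 0 <= x -> 1 + x + x ^+ 2 / 2 <= expR x.
Proof.
move=> x0.
suff <- : series (exp_coeff x) 3 = 1 + x + x ^+ 2 / 2.
  apply: nondecreasing_cvgn_le; last exact: is_cvg_series_exp_coeff.
  apply: nondecreasing_series => n _ _.
  by rewrite /exp_coeff /= divr_ge0// exprn_ge0.
rewrite /series /= !big_nat_recl// big_nil /exp_coeff /=.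
by rewrite expr0 expr1 !divr1 addr0 addrA.
Qed.

(** [expR x + expR (- x) - 2] is the square of [2 sinh (x / 2)], and
    [sinh z >= z] for [z >= 0]. *)
Lemma sqr_le_expRD (x : R) : 2 + x ^+ 2 <= expR x + expR (- x).
Proof.
wlog x0 : x / 0 <= x => [H|].
  have [/H//|x0] := leP 0 x.
  by rewrite [leRHS]addrC -sqrrN -{3}(opprK x); apply: H; rewrite oppr_ge0 ltW.
set z := x / 2; have z0 : 0 <= z by rewrite divr_ge0.
have xz : x = z + z by rewrite /z; field.
have := expR_ge_quadratic z0; have := expR_gt0 z.
rewrite xz opprD !expRD expRN; set e := expR z => e0 qe.
have ez : 2 * z <= e - e^-1.
  have q0 : 0 < 1 + z + z ^+ 2 / 2.
    by rewrite ltr_wpDr ?ltr_wpDr// divr_ge0// sqr_ge0.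
  apply: (@le_trans _ _ (1 + z + z ^+ 2 / 2 - (1 + z + z ^+ 2 / 2)^-1)).
    rewrite -subr_ge0 -(pmulr_lge0 _ q0) !mulrBl mulVf ?gt_eqF//.
    rewrite [leRHS](_ : _ = (z ^+ 2) ^+ 2 / 4); last by field.
    by rewrite divr_ge0// sqr_ge0.
  by rewrite lerB// lef_pV2.
have : (2 * z) ^+ 2 <= (e - e^-1) ^+ 2.
  by rewrite ler_sqr// nnegrE ?(le_trans _ ez)// mulr_ge0.
suff -> : e * e + e^-1 * e^-1 = 2 + (e - e^-1) ^+ 2 by lra.
by field; rewrite gt_eqF.
Qed.

(** Integrating [2 + v^2 x^2 <= expR (v x) + expR (- v x)] gives
    [2 + v^2 m <= 2 expR (v^2 / 2)] for the second moment [m].  The choice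
    [v = 1] shows that [m] is finite, and [v] tending to 0 that [m <= 1]. *)
Lemma normal_law_moment2 : (\int[normal_law 1]_x (x ^+ 2 : R)%:E <= 1)%E.
Proof.
have mX : measurable_fun setT (fun x : R => (x ^+ 2)%:E).
  by apply/measurable_EFinP; exact: measurable_funX.
have mE (v : R) : measurable_fun setT (fun x : R => (expR (v * x))%:E).
  by apply/measurable_EFinP; apply: measurableT_comp => //;
    exact: measurable_funM.
set m := integral _ _ _.
have m0 : (0 <= m)%E by apply: integral_ge0 => x _; rewrite lee_fin sqr_ge0.
have H v : (2%:E + (v ^+ 2)%:E * m <= (2 * expR (v ^+ 2 / 2))%:E)%E.
  have -> : (2 * expR (v ^+ 2 / 2))%:E =
      (\int[normal_law 1]_x ((expR (v * x))%:E + (expR (- v * x))%:E))%E.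
    rewrite ge0_integralD//.
    by rewrite !normal_law_mgf sqrrN -EFinD; congr EFin; ring.
  have -> : (2%:E + (v ^+ 2)%:E * m =
      \int[normal_law 1]_x (cst 2%:E x + (v ^+ 2)%:E * (x ^+ 2)%:E))%E.
    rewrite ge0_integralD//; last 3 first.
    - by move=> x _; rewrite lee_fin.
    - by move=> x _; rewrite -EFinM lee_fin mulr_ge0 ?sqr_ge0.
    - exact: measurable_funeM.
    rewrite integral_cst// [X in (_ = _ * X + _)%E]probability_setT mule1.
    rewrite ge0_integralZl//; first by move=> x _; rewrite lee_fin sqr_ge0.
    by rewrite lee_fin sqr_ge0.
  apply: ge0_le_integral => //.
  - move=> x _; rewrite /= -EFinM -EFinD lee_fin.
    by rewrite addr_ge0// mulr_ge0 ?sqr_ge0.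
  - by apply: emeasurable_funD => //; exact: measurable_funeM.
  - exact: emeasurable_funD.
  - move=> x _; rewrite /= -EFinM -!EFinD lee_fin -exprMn mulNr.
    exact: sqr_le_expRD.
clearbody m.
have mfin : m \is a fin_num.
  rewrite ge0_fin_numE//; have := H 1; rewrite expr1n mul1e.
  by clear H; case: m m0 => [r||]//= _ _; rewrite ltry.
rewrite -(fineK mfin) lee_fin leNgt; apply/negP => r1.
have {}H (w : R) : 0 < w < 1 -> fine m * (1 - w) <= 1.
  move=> /andP[w0 w1]; have w2 : 0 <= 2 * w by lra.
  have := H (Num.sqrt (2 * w)).
  rewrite -(fineK mfin) /= -EFinM -EFinD lee_fin sqr_sqrtr//.
  rewrite (_ : 2 * w / 2 = w); last by field.
  have ew : expR w * (1 - w) <= 1.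
    have := expR_ge1Dx (- w); rewrite expRN => /(ler_wpM2l (expR_ge0 w)).
    by rewrite divff// gt_eqF// expR_gt0.
  move=> h; rewrite -(ler_pM2l w0); nra.
have r0 : 0 < fine m by rewrite (lt_trans _ r1).
(* With this [w], [fine m * (1 - w)] is [(fine m + 1) / 2], which exceeds 1. *)
have := H ((1 - (fine m)^-1) / 2).
have i0 : 0 < (fine m)^-1 by rewrite invr_gt0.
have i1 : (fine m)^-1 < 1 by rewrite invf_lt1.
have im : fine m * (fine m)^-1 = 1 by rewrite divff// gt_eqF.
have w01 : 0 < (1 - (fine m)^-1) / 2 < 1 by apply/andP; split; lra.
by move=> /(_ w01); nra.
Qed.

End normal_shift.

(** * Translating a standard Gaussian vector *)

Section iid_integral.
Context {R : realType} {d} {S : measurableType d} (mu : probability S R).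

Lemma ge0_integral_iid_lawS k (f : k.+1.-tuple S -> \bar R) :
  measurable_fun setT f -> (forall t, (0 <= f t)%E) ->
  (\int[iid_law mu k.+1]_t f t =
   \int[mu]_x \int[iid_law mu k]_t f (tcons (x, t)))%E.
Proof.
move=> mf f0; rewrite ge0_integral_distribution// fubini_tonelli1//.
  by apply: measurableT_comp mf _; exact: measurable_tcons.
by move=> ?; exact: f0.
Qed.

End iid_integral.

Section gaussian_shift.
Context {R : realType}.

Definition translate k (v : 'I_k -> R) (t : k.-tuple R) : k.-tuple R :=
  [tuple v i + tnth t i | i < k].

Definition shift_density k (v : 'I_k -> R) (t : k.-tuple R) : R :=
  expR (\sum_(i < k) (v i * tnth t i - v i ^+ 2 / 2)).

Lemma measurable_translate k (v : 'I_k -> R) :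
  measurable_fun setT (translate v).
Proof.
apply/measurable_fun_tnthP => i.
rewrite (_ : _ \o _ = fun t : k.-tuple R => v i + tnth t i); last first.
  by apply/funext => t /=; rewrite tnth_mktuple.
by apply: measurable_funD => //; exact: measurable_tnth.
Qed.

Lemma measurable_shift_density k (v : 'I_k -> R) :
  measurable_fun setT (shift_density v).
Proof.
apply: measurableT_comp => //; apply: measurable_sum => i.
apply: measurable_funB => //; apply: measurable_funM => //.
exact: measurable_tnth.
Qed.

Lemma translate_tcons k (v : 'I_k.+1 -> R) x t :
  translate v (tcons (x, t)) = tcons (v ord0 + x, translate (v \o lift ord0) t).
Proof.
apply: eq_from_tnth => i; rewrite tnth_mktuple /tcons/=.
by case: (unliftP ord0 i) => [j|] ->; rewrite ?tnthS ?tnth_mktuple//= ?tnthS.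
Qed.

Lemma shift_density_tcons k (v : 'I_k.+1 -> R) x t :
  shift_density v (tcons (x, t)) =
  expR (v ord0 * x - v ord0 ^+ 2 / 2) * shift_density (v \o lift ord0) t.
Proof.
rewrite /shift_density big_ord_recl -expRD; congr (expR (_ + _)).
by apply: eq_bigr => i _; rewrite /tcons/= tnthS.
Qed.

(** The k-dimensional Cameron-Martin formula.  Induction on the dimension: the
    first coordinate is integrated last, against the one-dimensional formula. *)
Lemma ge0_integral_iid_normal_shift k (v : 'I_k -> R)
    (f : k.-tuple R -> \bar R) :
  measurable_fun setT f -> (forall t, (0 <= f t)%E) ->
  (\int[iid_law (normal_law 1) k]_t f (translate v t) =
   \int[iid_law (normal_law 1) k]_t (f t * (shift_density v t)%:E))%E.
Proof.
elim: k v f => [|k IH] v f mf f0.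
  apply: eq_integral => t _; rewrite /shift_density big_ord0 expR0 mule1.
  by congr f; apply: eq_from_tnth => -[].
have mfs : measurable_fun setT (fun t => f (translate v t)).
  exact: (measurableT_comp mf (measurable_translate v)).
have md j (w : 'I_j -> R) :
    measurable_fun setT (fun t => (shift_density w t)%:E).
  by apply/measurable_EFinP; exact: measurable_shift_density.
have d0 j (w : 'I_j -> R) t : (0 <= (shift_density w t)%:E)%E.
  by rewrite lee_fin expR_ge0.
have mfd : measurable_fun setT (fun t => f t * (shift_density v t)%:E)%E.
  by apply: emeasurable_funM => //; exact: md.
rewrite !ge0_integral_iid_lawS//; last by move=> t; exact: mule_ge0.
pose w := v \o lift ord0.
pose g x := (\int[iid_law (normal_law 1) k]_t
  (f (tcons (x, t)) * (shift_density w t)%:E))%E.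
have mfc x : measurable_fun setT (fun t : k.-tuple R => f (tcons (x, t))).
  by apply: (measurableT_comp mf); apply: measurable_cons => /=.
have g0 x : (0 <= g x)%E.
  by apply: integral_ge0 => t _; exact: mule_ge0.
have mg : measurable_fun setT g.
  apply: (measurable_fun_fubini_tonelli_F
    (fun p => (f (tcons p) * (shift_density w p.2)%:E)%E)) => //.
    apply: emeasurable_funM.
      by apply: (measurableT_comp mf); exact: measurable_tcons.
    by apply: (measurableT_comp (md _ w)).
  by move=> p; exact: mule_ge0.
transitivity (\int[normal_law 1]_x g (v ord0 + x)%R)%E.
  apply: eq_integral => x _; under eq_integral do rewrite translate_tcons.
  exact: (IH w (fun t => f (tcons (v ord0 + x, t)))).
rewrite ge0_integral_normal_law_shift//; apply: eq_integral => x _.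
under [RHS]eq_integral do rewrite shift_density_tcons EFinM muleCA.
rewrite ge0_integralZl ?lee_fin ?expR_ge0//; last 2 first.
- by apply: emeasurable_funM => //; exact: md.
- by move=> t _; exact: mule_ge0.
by rewrite muleC.
Qed.

End gaussian_shift.

(** * Total variation between translates of a Gaussian vector *)

Section tv.
Context {R : realType}.
Local Notation P k := (iid_law (@normal_law R 1) k).

(** With [s] the square root of a likelihood ratio and [a] the indicator of an
    event, this is
    [(a - 1/2) (s^2 - 1) <= (t (s - 1)^2 + (s + 1)^2 / t) / 4],
    the AM-GM bound on the product of [s - 1] and [s + 1].  The terms are
    arranged so that each side is a nonnegative combination of nonnegative
    functions, whose integrals then exist unconditionally. *)
Lemma hellinger_pointwise (a : bool) (s t : R) : 0 < t ->
  a%:R * s ^+ 2 + (t / 2 * s + 1 / 2) <=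
  a%:R + ((1 / 2 + t / 4 + (4 * t)^-1) * s ^+ 2 +
    ((2 * t)^-1 * s + (t / 4 + (4 * t)^-1))).
Proof.
move=> t0; rewrite -subr_ge0.
have tN : t != 0 by rewrite gt_eqF.
pose e : R := a%:R - 2^-1.
have e2 : e ^+ 2 = 4^-1 by rewrite /e; case: (a) => /=; field.
rewrite [leRHS](_ : _ = ((t * (s - 1) - 2 * e * (s + 1)) ^+ 2
   + (1 - 4 * e ^+ 2) * (s + 1) ^+ 2) / (4 * t)); last first.
  by rewrite /e; case: (a) => /=; field.
by rewrite e2 divff ?subrr ?mul0r ?addr0 ?divr_ge0 ?sqr_ge0 ?mulr_ge0// ltW.
Qed.

(** Integrating [hellinger_pointwise], where [s] has mean
    [B = expR (- |v|^2 / 8)] and mean square 1, bounds the increase of the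
    probability by [t (1 - B) / 2 + (1 + B) / (2 t)]; finally
    [1 - |v|^2 / 8 <= B <= 1].  Keeping [t] free, instead of optimizing it to
    [4 / |v|], makes the bound affine in [|v|^2], so that it can be averaged
    over a random [v] knowing only the mean of [|v|^2]. *)
Lemma iid_normal_translate_le k (v : 'I_k -> R) (A : set (k.-tuple R)) (t : R) :
  measurable A -> 0 < t ->
  (P k (translate v @^-1` A) <=
    P k A + (t / 16 * (\sum_(i < k) v i ^+ 2) + t^-1)%:E)%E.
Proof.
move=> mA t0.
set V := \sum_(i < k) v i ^+ 2.
pose B := expR (- (V / 8)).
pose s x := B * shift_density (fun i => v i / 2) x.
have s0 x : 0 <= s x by rewrite mulr_ge0 ?expR_ge0.
(* [s] is the square root of the density of the translate: halving [v] halves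
   the linear part of the exponent but quarters its quadratic part, and [B]
   makes up for the difference. *)
have sE x : shift_density v x = s x ^+ 2.
  rewrite /s /shift_density -expRD -expRM_natl; congr expR.
  rewrite mulrDr mulrN /V !(mulr_suml, mulr_sumr) -sumrN -big_split/=.
  by apply: eq_bigr => i _; field.
have md (w : 'I_k -> R) :
    measurable_fun setT (fun t => (shift_density w t)%:E).
  by apply/measurable_EFinP; exact: measurable_shift_density.
have ms : measurable_fun setT (fun t => (s t)%:E).
  apply/measurable_EFinP; apply: measurable_funM => //.
  exact: measurable_shift_density.
have d0 (w : 'I_k -> R) x : (0 <= (shift_density w x)%:E)%E.
  by rewrite lee_fin expR_ge0.
have d1 (w : 'I_k -> R) : (\int[P k]_t (shift_density w t)%:E = 1)%E.
  have /esym := ge0_integral_iid_normal_shift w (measurable_cst 1%E)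
    (fun=> lee01).
  rewrite integral_cst// mul1e [X in _ = X -> _]probability_setT => <-.
  by apply: eq_integral => x _; rewrite mul1e.
have is1 : (\int[P k]_x (s x)%:E = B%:E)%E.
  under eq_integral do rewrite EFinM.
  by rewrite ge0_integralZl ?d1 ?mule1// lee_fin expR_ge0.
have mI : measurable_fun setT (fun x => (\1_A x)%:E : \bar R).
  by apply/measurable_EFinP; exact: measurable_indic.
have iq : (P k (translate v @^-1` A) =
    \int[P k]_x ((\1_A x)%:E * (shift_density v x)%:E))%E.
  rewrite -(ge0_integral_iid_normal_shift v mI)//.
  rewrite -[X in P k X]setIT -integral_indic//.
  rewrite -[X in measurable X]setTI; exact: measurable_translate.
have H : (P k (translate v @^-1` A) + ((t / 2)%:E * B%:E + (1 / 2)%:E) <=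
  P k A + ((1 / 2 + t / 4 + (4 * t)^-1)%:E * 1 +
    ((2 * t)^-1%:E * B%:E + (t / 4 + (4 * t)^-1)%:E)))%E.
  have t2 : 0 <= t / 2 by rewrite divr_ge0// ltW.
  have c1 : 0 <= 1 / 2 + t / 4 + (4 * t)^-1.
    by rewrite !addr_ge0 ?invr_ge0 ?divr_ge0 ?mulr_ge0// ltW.
  have c2 : 0 <= (2 * t)^-1 by rewrite invr_ge0 mulr_ge0// ltW.
  have c3 : 0 <= t / 4 + (4 * t)^-1.
    by rewrite !addr_ge0 ?invr_ge0 ?divr_ge0 ?mulr_ge0// ltW.
  have sZ0 c : 0 <= c -> forall x, setT x -> (0 <= c%:E * (s x)%:E)%E.
    by move=> c0 x _; rewrite -EFinM lee_fin mulr_ge0.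
  have dZ0 c : 0 <= c ->
      forall x, setT x -> (0 <= c%:E * (shift_density v x)%:E)%E.
    by move=> c0 x _; rewrite -EFinM lee_fin mulr_ge0// sE sqr_ge0.
  have msZ c : measurable_fun setT (fun x => c%:E * (s x)%:E)%E.
    exact: measurable_funeM.
  have mdZ c : measurable_fun setT (fun x => c%:E * (shift_density v x)%:E)%E.
    by apply: measurable_funeM; exact: md.
  have affine c c' : 0 <= c -> 0 <= c' ->
      (\int[P k]_x (c%:E * (s x)%:E + cst c'%:E x) = c%:E * B%:E + c'%:E)%E.
    move=> c0 c'0; rewrite ge0_integralD//; last exact: sZ0.
    rewrite ge0_integralZl//; last by move=> x _; exact: s0.
    by rewrite is1 integral_cst// [X in (_ + _ * X)%E]probability_setT mule1.
  rewrite -!affine// -(d1 v) -ge0_integralZl//.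
  have -> : P k A = (\int[P k]_x (\1_A x)%:E)%E.
    by rewrite integral_indic// setIT.
  have a0 c c' : 0 <= c -> 0 <= c' ->
      forall x, setT x -> (0 <= c%:E * (s x)%:E + cst c'%:E x)%E.
    by move=> c0 c'0 x _; rewrite adde_ge0 ?sZ0 ?lee_fin.
  have ma c c' : measurable_fun setT (fun x => c%:E * (s x)%:E + cst c'%:E x)%E.
    by apply: emeasurable_funD.
  have I0 x : setT x -> (0 <= (\1_A x)%:E * (shift_density v x)%:E)%E.
    by move=> _; apply: mule_ge0; [rewrite lee_fin indicE ler0n|exact: d0].
  rewrite iq -!ge0_integralD//; last 6 first.
  - by move=> x _; rewrite adde_ge0 ?dZ0 ?a0.
  - exact: emeasurable_funD.
  - exact: dZ0.
  - exact: a0.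
  - by apply: emeasurable_funM => //; exact: md.
  - exact: a0.
  apply: ge0_le_integral => //.
  - by move=> x _; rewrite adde_ge0 ?a0 ?I0.
  - by apply: emeasurable_funD => //; apply: emeasurable_funM => //; exact: md.
  - by apply: emeasurable_funD => //; apply: emeasurable_funD.
  - move=> x _; rewrite /= !sE -!EFinM -!EFinD lee_fin indicE.
    exact: hellinger_pointwise.
have mvA : measurable (translate v @^-1` A).
  by rewrite -[X in measurable X]setTI; exact: measurable_translate.
move: H; rewrite -(fineK (fin_num_measure (P k) _ mA)).
rewrite -(fineK (fin_num_measure (P k) _ mvA)) mule1.
rewrite -!EFinM -!EFinD !lee_fin => h.
have B1 : B <= 1.
  rewrite -expR0 ler_expR oppr_le0 divr_ge0// sumr_ge0// => i _.
  exact: sqr_ge0.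
have BV : 1 - V / 8 <= B by rewrite expR_ge1Dx.
have tB : (2 * t)^-1 * B <= (2 * t)^-1.
  by rewrite ler_piMr// invr_ge0 mulr_ge0// ltW.
have tt : t^-1 = 2 * (2 * t)^-1 by field; rewrite gt_eqF.
have t4 : (2 * t)^-1 = 2 * (4 * t)^-1 by field; rewrite gt_eqF.
nra.
Qed.

End tv.

Section moment.
Context {R : realType}.
Local Notation P k := (iid_law (@normal_law R 1) k).

Lemma measurable_sum_sqr k :
  measurable_fun setT (fun t : k.-tuple R => (\sum_(i < k) tnth t i ^+ 2)%:E).
Proof.
apply/measurable_EFinP; apply: measurable_sum => i.
by apply: measurable_funX; exact: measurable_tnth.
Qed.

Lemma sum_sqr_ge0 k (t : k.-tuple R) :
  (0 <= (\sum_(i < k) tnth t i ^+ 2)%:E)%E.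
Proof. by rewrite lee_fin sumr_ge0// => i _; rewrite sqr_ge0. Qed.

Lemma iid_normal_moment2 k :
  (\int[P k]_t (\sum_(i < k) tnth t i ^+ 2 : R)%:E <= k%:R%:E)%E.
Proof.
elim: k => [|k IH].
  under eq_integral do rewrite big_ord0.
  by rewrite integral0.
rewrite ge0_integral_iid_lawS; [|exact: measurable_sum_sqr|exact: sum_sqr_ge0].
have mX : measurable_fun setT (fun x : R => (x ^+ 2)%:E).
  by apply/measurable_EFinP; exact: measurable_funX.
have X0 (x : R) : setT x -> (0 <= (x ^+ 2)%:E)%E.
  by move=> _; rewrite lee_fin sqr_ge0.
apply: (@le_trans _ _ (\int[normal_law 1]_x ((x ^+ 2)%:E + cst k%:R%:E x)))%E.
  apply: ge0_le_integral => //.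
  - move=> x _; apply: integral_ge0 => t _; exact: sum_sqr_ge0.
  - apply: (@measurable_fun_fubini_tonelli_F _ _ _ _ R (P k)
      (fun p : R * k.-tuple R => (\sum_(i < k.+1) tnth (tcons p) i ^+ 2)%:E)).
      apply: (measurableT_comp (@measurable_sum_sqr k.+1)).
      exact: measurable_tcons.
    by move=> p; exact: sum_sqr_ge0.
  - exact: emeasurable_funD.
  move=> x _.
  under eq_integral => t _.
    rewrite big_ord_recl EFinD /tcons tnth0; under eq_bigr do rewrite tnthS.
    over.
  rewrite /= ge0_integralD//; last 3 first.
  - by move=> t _; rewrite lee_fin sqr_ge0.
  - by move=> t _; exact: sum_sqr_ge0.
  - exact: measurable_sum_sqr.
  by rewrite integral_cst// [X in (_ * X + _)%E]probability_setT mule1 leeD2l.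
rewrite ge0_integralD//; last by move=> x _; rewrite lee_fin.
rewrite integral_cst// [X in (_ + _ * X)%E]probability_setT mule1.
by apply: (le_trans (leeD2r _ normal_law_moment2)); rewrite -EFinD nat1r.
Qed.

End moment.

(** * A slope change absorbed by the low-rank term *)

Section model_bound.
Context {R : realType} (n T : nat).
Local Notation P k := (iid_law (@normal_law R 1) k).
Implicit Types (M D U : 'M[R]_(n, T)) (A : set ('M[R]_(n, T) * 'M[R]_(n, T))).

Lemma mxvec_mx_of_tuple (t : (n * T).-tuple R) k :
  mxvec (mx_of_tuple t) 0 k = tnth t k.
Proof. by case/mxvec_indexP: k => i j; rewrite mxvecE mxE. Qed.

Lemma mx_of_tuple_translate U (b : R) (t : (n * T).-tuple R) :
  mx_of_tuple (translate (fun k => b * mxvec U 0 k) t) =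
  b *: U + mx_of_tuple t.
Proof. by apply/matrixP => i j; rewrite !mxE tnth_mktuple mxvecE. Qed.

(** The two laws share [X = D + u], and given [u] the law of [Y] is translated
    by [b u].  Hence the total variation bound applies conditionally on [u],
    with [t = 4 / h]; as [E |u|^2 = nT], both of its terms average to at most
    [h / 4]. *)
Lemma data_law_confounded_le M D (b h : R) A : measurable A -> 0 < h ->
  b ^+ 2 * (n * T)%:R <= h ^+ 2 ->
  (data_law (Param (M - b *: D) D 1 1 b) A <=
   data_law (Param M D 1 1 0) A + (h / 2)%:E)%E.
Proof.
move=> mA h0 bh.
set th1 := Param _ _ _ _ b; set th0 := Param _ _ _ _ 0.
pose B th := data_of_noise th @^-1` A.
have mB th : measurable (B th).
  by rewrite -[X in measurable X]setTI; exact: measurable_data_of_noise.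
have dE th : sigma_u th = 1 -> sigma_eps th = 1 ->
    data_law th A =
    (\int[noise_law n T 1]_U noise_law n T 1 (xsection (B th) U))%E.
  by case: th => ? ? ? ? ?/= -> ->.
have sxE th U : noise_law n T 1 (xsection (B th) U) =
    P (n * T) (@mx_of_tuple R n T @^-1` xsection (B th) U) by [].
pose S U := \sum_(k < n * T) mxvec U 0 k ^+ 2.
have mS : measurable_fun setT (fun U => (S U)%:E).
  apply/measurable_EFinP; apply: measurable_sum => k; apply: measurable_funX.
  case/mxvec_indexP: k => i j.
  by under eq_fun do rewrite mxvecE; exact: measurable_entry.
have S0 U : (0 <= (S U)%:E)%E.
  by rewrite lee_fin sumr_ge0// => k _; rewrite sqr_ge0.
have iS : (\int[noise_law n T 1]_U (S U)%:E <= (n * T)%:R%:E)%E.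
  rewrite ge0_integral_distribution//; apply: le_trans (iid_normal_moment2 _).
  rewrite le_eqVlt; apply/orP; left; apply/eqP/eq_integral => t _.
  by rewrite /S/=; congr EFin; apply: eq_bigr => k _; rewrite mxvec_mx_of_tuple.
pose c := b ^+ 2 / (4 * h).
have c0 : 0 <= c by rewrite divr_ge0 ?sqr_ge0// mulr_ge0// ltW.
have h40 : 0 <= h / 4 by rewrite divr_ge0// ltW.
have pt U : (noise_law n T 1 (xsection (B th1) U) <=
    noise_law n T 1 (xsection (B th0) U) +
    (c%:E * (S U)%:E + (cst (h / 4)%:E U)))%E.
  rewrite !sxE.
  rewrite [X in P _ X](_ : _ = translate (fun k => b * mxvec U 0 k) @^-1`
      (@mx_of_tuple R n T @^-1` xsection (B th0) U)); last first.
    have E t : data_of_noise th1 (U, mx_of_tuple t) = data_of_noise th0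
        (U, mx_of_tuple (translate (fun k => b * mxvec U 0 k) t)).
      rewrite /data_of_noise mx_of_tuple_translate/=; congr (_, _).
      by apply/matrixP => i j; rewrite !mxE; ring.
    by apply/seteqP; split=> t; rewrite /xsection /B/= !inE/= E.
  have t0 : 0 < 4 / h by rewrite divr_gt0.
  apply: (le_trans (iid_normal_translate_le _ _ t0)).
    rewrite -[X in measurable X]setTI; apply: measurable_mx_of_tuple => //.
    exact: measurable_xsection.
  rewrite leeD2l// /cst -EFinM -EFinD lee_fin /S /c invf_div.
  rewrite le_eqVlt; apply/orP; left; apply/eqP; congr (_ + _).
  under eq_bigr do rewrite exprMn.
  by rewrite -mulr_sumr; field; rewrite gt_eqF.
have mN th : measurable_fun setT (fun U => noise_law n T 1 (xsection (B th) U)).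
  exact: measurable_fun_xsection.
have cS0 U : (0 <= c%:E * (S U)%:E)%E by exact: mule_ge0.
have mcS : measurable_fun setT (fun U => c%:E * (S U)%:E)%E.
  exact: measurable_funeM.
rewrite !dE//.
apply: (@le_trans _ _ (\int[noise_law n T 1]_U
    (noise_law n T 1 (xsection (B th0) U) +
     (c%:E * (S U)%:E + cst (h / 4)%:E U)))%E).
  apply: ge0_le_integral => //.
  by do 2!apply: emeasurable_funD => //.
have cc0 U : (0 <= c%:E * (S U)%:E + cst (h / 4)%:E U)%E.
  by apply: adde_ge0; rewrite ?cS0// lee_fin.
rewrite ge0_integralD//; last by apply: emeasurable_funD.
rewrite leeD2l// ge0_integralD//.
rewrite ge0_integralZl// integral_cst//.
rewrite [X in (_ + _ * X)%E]probability_setT mule1.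
apply: (le_trans (leeD2r _ (lee_wpmul2l _ iS))); first by rewrite lee_fin.
rewrite -EFinM -EFinD lee_fin.
have : c * (n * T)%:R <= h / 4.
  rewrite /c mulrAC ler_pdivrMr ?mulr_gt0// (le_trans bh)//.
  by rewrite le_eqVlt; apply/orP; left; apply/eqP; field.
lra.
Qed.

End model_bound.

(** * The two-point argument *)

Section two_points.
Context {R : realType} (n T : nat).

Lemma normF_delta (a : R) i j :
  0 <= a -> normF (a *: delta_mx i j : 'M[R]_(n, T)) = a.
Proof.
move=> a0; rewrite /normF (bigD1 i)//= (bigD1 j)//= big1 => [|k kj].
  rewrite big1 => [|k ki].
    by rewrite !addr0 !mxE !eqxx mulr1 sqrtr_sqr ger0_norm.
  by apply: big1 => m _; rewrite !mxE (negbTE ki) mulr0 expr0n.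
by rewrite !mxE (negbTE kj) andbF mulr0 expr0n.
Qed.

(** Multiples of two matrix units sharing no row and no column are rank-one,
    orthogonal on both sides, and can be given any norm. *)
Lemma Theta_confounded_pair (kappa1 kappa2 : R) :
  0 < kappa1 -> 0 < kappa2 -> (1 < n)%N -> (1 < T)%N ->
  exists M D : 'M[R]_(n, T), forall b, `|b| <= 1 ->
    Theta1 n T kappa1 kappa2 (Param M D 1 1 0) /\
    Theta2 n T (Param (M - b *: D) D 1 1 b).
Proof.
move=> k1 k2 n1 T1.
pose i0 := Ordinal (ltnW n1); pose i1 := Ordinal n1.
pose j0 := Ordinal (ltnW T1); pose j1 := Ordinal T1.
pose N : R := Num.sqrt (n * T)%:R.
have N0 : 0 < N by rewrite sqrtr_gt0 ltr0n muln_gt0 ltnW// ltnW.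
have rk a i j : 0 < a -> \rank (a *: delta_mx i j : 'M[R]_(n, T)) = 1%N.
  by move=> a0; rewrite mxrank_scale_nz ?mxrank_delta// gt_eqF.
exists ((kappa1 * N) *: delta_mx i0 j0), ((kappa2 * N) *: delta_mx i1 j1).
move=> b b1; have a1 : 0 < kappa1 * N by exact: mulr_gt0.
have a2 : 0 < kappa2 * N by exact: mulr_gt0.
have T2 : Theta2 n T (Param ((kappa1 * N) *: delta_mx i0 j0)
    ((kappa2 * N) *: delta_mx i1 j1) 1 1 0).
  by split; rewrite /= ?rk// normr0.
split.
- split => //=; rewrite ?rk//; last 2 first.
  + by rewrite normF_delta// ltW.
  + by rewrite normF_delta// ltW.
  rewrite !linearZ/= -!scalemxAl !trmx_delta !mul_delta_mx_cond.
  by rewrite !mulr0n !scaler0.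
- split => //=; rewrite ?rk//.
  apply: leq_trans (mxrank_add _ _) _.
  rewrite rk// mxrank_opp.
  apply: (@leq_add 1%N _ 1%N) => //.
  by rewrite (leq_trans (mxrank_scale _ _))// rk.
Qed.

(** Both coverage events are compared under the single law [P0] at [beta = 0]:
    there they overlap only when the interval is longer than [r], so their
    probabilities add up to at most [1 + delta]. *)
Lemma ereal_inf_coverage_le (kappa1 kappa2 : R)
    (l u : 'M[R]_(n, T) * 'M[R]_(n, T) -> R) (r b h delta : R) :
  0 < kappa1 -> 0 < kappa2 -> (1 < n)%N -> (1 < T)%N ->
  measurable_fun setT l -> measurable_fun setT u ->
  r < b -> 0 <= b <= 1 -> 0 < h -> b ^+ 2 * (n * T)%:R <= h ^+ 2 ->
  (ereal_sup [set data_law th [set z | (r < u z - l z)%R]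
     | th in Theta1 n T kappa1 kappa2] <= delta%:E)%E ->
  (ereal_inf [set data_law th [set z | (l z <= beta th <= u z)%R]
     | th in Theta2 n T] <= (1 / 2 + h / 4 + delta / 2)%:E)%E.
Proof.
move=> k1 k2 n1 T1 ml mu rb /andP[b0 b1] h0 bh.
have [M [D /(_ b)]] := Theta_confounded_pair k1 k2 n1 T1.
rewrite ger0_norm// => /(_ b1)[th0 th1] supd.
set P0 := data_law (Param M D 1 1 0) in supd *.
set I := ereal_inf _.
have mle x : measurable [set z | (l z <= x <= u z)%R].
  rewrite (_ : mkset _ = l @^-1` `]-oo, x] `&` u @^-1` `[x, +oo[).
    by apply: measurableI; rewrite -[X in measurable X]setTI;
      [exact: ml|exact: mu].
  apply/seteqP; split=> z /=; rewrite !in_itv/= andbT.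
    by move/andP.
  by case=> -> ->.
set A0 := [set z | (l z <= 0 <= u z)%R].
set A1 := [set z | (l z <= b <= u z)%R].
have mA0 : measurable A0 := mle 0.
have mA1 : measurable A1 := mle b.
have mW : measurable [set z | r < u z - l z].
  rewrite (_ : mkset _ = (u \- l)%R @^-1` `]r, +oo[).
    by rewrite -[X in measurable X]setTI; apply: measurable_funB.
  by apply/seteqP; split=> z /=; rewrite in_itv/= andbT.
have I0 : (I <= P0 A0)%E.
  by apply: ereal_inf_lbound; exists (Param M D 1 1 0) => //; case: th0.
have I1 : (I <= P0 A1 + (h / 2)%:E)%E.
  apply: (@le_trans _ _ (data_law (Param (M - b *: D) D 1 1 b) A1)).
    by apply: ereal_inf_lbound; exists (Param (M - b *: D) D 1 1 b).
  exact: data_law_confounded_le.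
have W : (P0 (A0 `&` A1) <= delta%:E)%E.
  apply: le_trans supd; apply: (@le_trans _ _ (P0 [set z | (r < u z - l z)%R])).
    apply: le_measure; rewrite ?inE//; first exact: measurableI.
    move=> z [/= /andP[l0 _] /andP[_ ub]]; lra.
  by apply: ereal_sup_ubound; exists (Param M D 1 1 0).
have U : (P0 A0 + P0 A1 <= 1 + delta%:E)%E.
  have mD : measurable (A1 `\` A0) by exact: measurableD.
  rewrite [X in (_ + X)%E](measureDI P0 mA1 mA0) addeA.
  rewrite leeD//; last by rewrite setIC.
  rewrite -measureU//; last by apply/seteqP; split=> z //= -[? []].
  by apply: probability_le1; exact: measurableU.
move: I0 I1 U.
rewrite -(fineK (fin_num_measure P0 _ mA0)) -(fineK (fin_num_measure P0 _ mA1)).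
rewrite -!EFinD lee_fin.
have : (0 <= I)%E by apply: le_ereal_inf_tmp => _ [th _ <-].
case: I => [i||]//= _; rewrite !lee_fin; lra.
Qed.

End two_points.

Theorem corollary3 (R : realType) (kappa1 kappa2 : R)
    (l u : forall n T : nat, 'M[R]_(n, T) * 'M[R]_(n, T) -> R) :
  0 < kappa1 -> 0 < kappa2 ->
  (forall n T, measurable_fun setT (l n T)) ->
  (forall n T, measurable_fun setT (u n T)) ->
  (forall n T z, l n T z <= u n T z) ->
  (forall eta : R, 0 < eta < 1 ->
     limf_esup (fun nT : nat * nat =>
         ereal_sup [set data_law th [set z |
               392 / 100 * (Num.sqrt (nT.1 * nT.2)%:R)^-1
                 * (Num.sqrt (1 + kappa2 ^+ 2))^-1 * (1 + eta)
               < u nT.1 nT.2 z - l nT.1 nT.2 z]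
           | th in Theta1 nT.1 nT.2 kappa1 kappa2])
       (filter_prod \oo \oo) = 0%E) ->
  (limf_einf (fun nT : nat * nat =>
       ereal_inf [set data_law th [set z |
             (l nT.1 nT.2 z <= beta th <= u nT.1 nT.2 z)%R]
         | th in Theta2 nT.1 nT.2])
     (filter_prod \oo \oo)
   <= (1 / 2 + 196 / 100 * (Num.sqrt (1 + kappa2 ^+ 2))^-1)%:E)%E.
Proof.
move=> k1 k2 ml mu _ Hlen.
pose s := Num.sqrt (1 + kappa2 ^+ 2).
pose c := 196 / 100 * s^-1.
have s0 : 0 < s by rewrite sqrtr_gt0 ltr_wpDr// sqr_ge0.
have c0 : 0 < c by rewrite mulr_gt0 ?invr_gt0// divr_gt0.
(* A single [eta] suffices: 1/2 leaves the length bound [3 c / N] below the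
   distance [4 c / N] between the two slopes. *)
have h01 : 0 < (1 / 2 : R) by lra.
have h1 : (1 / 2 : R) < 1 by lra.
have {h01 h1 Hlen} := Hlen (1 / 2) (introT andP (conj h01 h1)).
set F := (X in limf_esup X _); rewrite limf_esupE limf_einfE => H.
apply/lee_addgt0Pr => e e0; apply: ge_ereal_sup => _ [V FV <-].
have /ereal_inf_lt[_ [W FW <-] We] : (ereal_inf [set ereal_sup (F @` V)
    | V in filter_prod \oo \oo] < e%:E)%E by rewrite H lte_fin.
(* From [N0] on, both dimensions are at least 2 and [4 c / N] is at most 1. *)
pose N0 := maxn 2 (Num.bound ((4 * c) ^+ 2)).
have FN : filter_prod \oo \oo
    [set nT : nat * nat | (N0 <= nT.1)%N /\ (N0 <= nT.2)%N].
  exists ([set n | (N0 <= n)%N], [set n | (N0 <= n)%N]) => /=.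
    by split; exact: nbhs_infty_ge.
  by move=> [].
have [[n T] [[Vn Wn] /= [nN TN]]] :=
  @filter_ex _ _ _ _ (filterI (filterI FV FW) FN).
have n2 : (1 < n)%N by rewrite (leq_trans _ nN)// leq_maxl.
have T2 : (1 < T)%N by rewrite (leq_trans _ TN)// leq_maxl.
pose N : R := Num.sqrt (n * T)%:R.
have nT0 : 0 < (n * T)%:R :> R by rewrite ltr0n muln_gt0 ltnW// ltnW.
have N0' : 0 < N by rewrite sqrtr_gt0.
have N2 : N ^+ 2 = (n * T)%:R by rewrite sqr_sqrtr// ltW.
have cN : (4 * c) ^+ 2 <= N ^+ 2.
  have /ltW/le_trans := archi_boundP (sqr_ge0 (4 * c)); apply.
  rewrite N2 ler_nat; apply: (@leq_trans N0); first exact: leq_maxr.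
  by rewrite (leq_trans nN)// leq_pmulr// ltnW.
have c4 : 0 < 4 * c by rewrite mulr_gt0.
have {}cN : 4 * c <= N by rewrite -ler_sqr// nnegrE ltW.
apply: (@le_trans _ _ (ereal_inf [set data_law th [set z |
  (l n T z <= beta th <= u n T z)%R] | th in Theta2 n T])).
  by apply: ereal_inf_lbound; exists (n, T).
have Fe : (F (n, T) <= e%:E)%E.
  by apply: (le_trans _ (ltW We)); apply: ereal_sup_ubound; exists (n, T).
rewrite (_ : (1 / 2 + _)%:E + e%:E = (1 / 2 + 4 * c / 4 + e)%:E)%E; last first.
  by rewrite -EFinD; congr EFin; rewrite /c /s; field; rewrite gt_eqF.
have bN : (4 * c / N) ^+ 2 * (n * T)%:R <= (4 * c) ^+ 2.
  by rewrite -N2 -exprMn divfK// gt_eqF.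
have b01 : 0 <= 4 * c / N <= 1.
  by rewrite divr_ge0 ?(ltW c4) ?(ltW N0')//= ler_pdivrMr// mul1r.
have rb : 392 / 100 * N^-1 * s^-1 * (1 + 1 / 2) < 4 * c / N.
  rewrite (_ : _ * (1 + _) = 3 * c / N); last first.
    by rewrite /c; field; rewrite !gt_eqF.
  by rewrite ltr_pM2r ?invr_gt0// ltr_pM2r// ltr_nat.
apply: le_trans (ereal_inf_coverage_le k1 k2 n2 T2 (ml n T) (mu n T)
  rb b01 c4 bN Fe) _.
by rewrite lee_fin; lra.
Qed.
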